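(* Let $\Omega\subseteq\mathbb{R}^n$ be open and let $u=(u_\varepsilon)\in\mathcal{P}^{\mathrm{e}}(\Omega)=\prod_{\varepsilon\in I^{\mathrm{e}}}\mathcal{C}^\infty(\Omega_\varepsilon,\mathbb{R})$. Then: (i) $u^\vee\in\mathcal{E}_M^{\mathrm{e}}(\Omega)$ if and only if $\forall K\Subset\Omega\ \forall\alpha\in\mathbb{N}^n\ \exists N\in\mathbb{N}:\ \sup_{x\in K}|\partial^\alpha u_\varepsilon(x)|=O(\underline{\varepsilon}^{-N})$ as $\varepsilon\in\mathbb{I}^{\mathrm{e}}$; (ii) $u^\vee\in\mathcal{N}^{\mathrm{e}}(\Omega)$ if and only if $\forall K\Subset\Omega\ \forall\alpha\in\mathbb{N}^n\ \forall m\in\mathbb{N}:\ \sup_{x\in K}|\partial^\alpha u_\varepsilon(x)|=O(\underline{\varepsilon}^{m})$ as $\varepsilon\in\mathbb{I}^{\mathrm{e}}$.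
   Context: $\mathbb{N}=\{0,1,2,\dots\}$, $n\ge1$; $K\Subset\Omega$ means $K$ is a compact subset of $\Omega$. $\mathcal{D}(\mathbb{R}^n)$ is the space of (real-valued) test functions. For $\varphi\in\mathcal{D}(\mathbb{R}^n)$ and $r>0$, $(r\odot\varphi)(y):=r^{-n}\varphi(y/r)$. For $\varphi\neq0$, $\underline{\varphi}:=\mathrm{diam}(\mathrm{supp}(\varphi))$. Index structure: $\mathcal{A}_0:=\{\varphi\in\mathcal{D}(\mathbb{R}^n)\mid\int\varphi=1\}$; for $q\in\mathbb{N}$, $\mathcal{A}_q:=\{\varphi\in\mathcal{A}_0\mid\int x^\alpha\varphi(x)\,dx=0\ \forall\alpha\in\mathbb{N}^n,\ 1\le|\alpha|\le q\}$. $\mathbb{I}^{\mathrm{e}}=(I^{\mathrm{e}},\le,\mathcal{I}^{\mathrm{e}})$ with $I^{\mathrm{e}}:=\mathcal{A}_0$, $\mathcal{I}^{\mathrm{e}}:=\{\mathcal{A}_q\mid q\in\mathbb{N}\}$, and $\varepsilon\le e$ iff there is $r\in(0,1]$ with $\varepsilon=r\odot e$. Put $(\emptyset,e]:=\{\varepsilon\in I^{\mathrm{e}}\mid\varepsilon\le e\}$ and $A_{\le e}:=(\emptyset,e]\cap A$. Big-O: for real nets indexed by $I^{\mathrm{e}}$, $x_\varepsilon=O(y_\varepsilon)$ as $\varepsilon\in\mathbb{I}^{\mathrm{e}}$ means: there is $A\in\mathcal{I}^{\mathrm{e}}$ such that for all $a\in A$ there are $H>0$ and $\varepsilon_0\in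 A_{\le a}$ with $|x_\varepsilon|\le H|y_\varepsilon|$ for all $\varepsilon\in A_{\le\varepsilon_0}$. Full algebra: $U(\Omega):=\{(\varphi,x)\in\mathcal{A}_0\times\Omega\mid\mathrm{supp}(\varphi)\subseteq\Omega-x\}$ and, for $\varphi\in\mathcal{A}_0$, $\Omega_\varphi:=\{x\in\Omega\mid\mathrm{supp}(\varphi)\subseteq\Omega-x\}$. $\mathcal{E}^{\mathrm{e}}(\Omega)$ is the set of all $R:U(\Omega)\to\mathbb{R}$ such that $R(\varphi,-)$ is smooth on $\Omega_\varphi$ for all $\varphi\in\mathcal{A}_0$. $R\in\mathcal{E}^{\mathrm{e}}_M(\Omega)$ iff $R\in\mathcal{E}^{\mathrm{e}}(\Omega)$ and $\forall K\Subset\Omega\,\forall\alpha\in\mathbb{N}^n\,\exists N\in\mathbb{N}\,\forall\varphi\in\mathcal{A}_N$: $\sup_{x\in K}|\partial^\alpha R(r\odot\varphi,x)|=O(r^{-N})$ as $r\to0^+$. $R\in\mathcal{N}^{\mathrm{e}}(\Omega)$ iff $R\in\mathcal{E}^{\mathrm{e}}(\Omega)$ and $\forall K\Subset\Omega\,\forall\alpha\in\mathbb{N}^n\,\forall m\in\mathbb{N}\,\exists q\in\mathbb{N}\,\forall\varphi\in\mathcal{A}_q$: $\sup_{x\in K}|\partial^\alpha R(r\odot\varphi,x)|=O(r^{m})$ as $r\to0^+$. Here $\partial^\alpha$ acts on the variable $x$. For $u\in\mathcal{P}^{\mathrm{e}}(\Omega)$, $u^\vee:U(\Omega)\to\mathbb{R}$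 is $u^\vee(\varphi,x):=u_\varphi(x)$. Convention: the supremum over $K$ is meaningful when $K\subseteq\Omega_\varepsilon$; for fixed $\varphi$ and $K$ this holds for $\varepsilon=r\odot\varphi$ with $r$ sufficiently small, and the (arbitrary) value assigned to the supremum when $K\not\subseteq\Omega_\varepsilon$ (say $0$) is irrelevant. *)

(* Defs.v *)
(* Functions on open subsets of R^n, nets indexed by A_0 and functions on
   U(Omega) are total.  Their values outside the mathematical domain are
   irrelevant: continuity and derivatives are only considered at points of open
   sets on which the function is meaningful, and nets only on A_0. *)
From HB Require Import structures.
From mathcomp Require Import all_boot all_order all_algebra.
From mathcomp Require Import all_classical all_reals all_analysis.

Set Implicit Arguments.
Unset Strict Implicit.
Unset Printing Implicit Defensive.

Import Order.TTheory GRing.Theory Num.Theory.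
Import numFieldNormedType.Exports.

Local Open Scope classical_set_scope.
Local Open Scope ring_scope.

(* Lebesgue measure on R^n lives on the iterated product R * (R * (... * unit))
   with its product sigma-algebra; the library has no measurable structure on
   'rV[R]_n. *)

Section lebesgue_prod.
Context (R : realType) (d : measure_display) (T : measurableType d).
Variable mu : {sigma_finite_measure set T -> \bar R}.

(* An alias of the product measure: the library does not make [\x] canonically
   sigma-finite, which the recursion below needs. *)
Definition lebesgue_prod : set (measurableTypeR R * T) -> \bar R :=
  (@lebesgue_measure R \x mu)%E.

HB.instance Definition _ := Measure.on lebesgue_prod.

Let lebesgue_prod_sigma_finite : sigma_finite setT lebesgue_prod.
Proof.
have /sigma_finiteP[F [TF ndF Foo]] := sigma_finiteT (@lebesgue_measure R).
have /sigma_finiteP[G [TG ndG Goo]] := sigma_finiteT mu.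
exists (fun n => F n `*` G n).
  rewrite -setXTT TF TG predeqE => -[x y]; split.
    move=> [/= [n _ Fnx] [k _ Gky]]; exists (maxn n k) => //; split.
    - by move: x Fnx; exact/subsetPset/ndF/leq_maxl.
    - by move: y Gky; exact/subsetPset/ndG/leq_maxr.
  by move=> [n _ []/= ? ?]; split; exists n.
move=> k; have [? ?] := Foo k; have [? ?] := Goo k.
split; first exact: measurableX.
by rewrite [lebesgue_prod _]product_measure1E// lte_mul_pinfty// ge0_fin_numE.
Qed.

HB.instance Definition _ := Measure_isSigmaFinite.Build _ _ _ lebesgue_prod
  lebesgue_prod_sigma_finite.

End lebesgue_prod.

Definition display_of (d : measure_display) (T : measurableType d) := d.

Fixpoint coord_display (R : realType) (n : nat) : measure_display :=
  if n is m.+1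
  then measure_prod_display (display_of (measurableTypeR R), coord_display R m)
  else default_measure_display.

Fixpoint coordType (R : realType) (n : nat) :
    measurableType (coord_display R n) :=
  if n is m.+1 return measurableType (coord_display R n)
  then (measurableTypeR R * coordType R m)%type else unit.

Fixpoint lebesgue_coord (R : realType) (n : nat) :
    {sigma_finite_measure set (coordType R n) -> \bar R} :=
  if n is m.+1
      return {sigma_finite_measure set (coordType R n) -> \bar R}
  then lebesgue_prod (lebesgue_coord R m)
  else \d_tt.

Fixpoint coord (R : realType) (n : nat) : coordType R n -> nat -> R :=
  if n is m.+1 return coordType R n -> nat -> R
  then fun t k => if k is j.+1 then coord t.2 j else t.1
  else fun _ _ => 0.

Section euclidean_space.
Context {R : realType} {n : nat}.
Implicit Types (f g phi : 'rV[R]_n -> R) (x y : 'rV[R]_n) (W : set 'rV[R]_n).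

Definition point_of_coord (t : coordType R n) : 'rV[R]_n := \row_i coord t i.

Definition integralRn f : R :=
  \int[lebesgue_coord R n]_t f (point_of_coord t).

(* The library's norm on 'rV[R]_n is the sup norm: same topology as the
   Euclidean norm, but not the same diameters. *)
Definition enorm x : R := Num.sqrt (\sum_i x 0 i ^+ 2).

Definition diam W : R := sup [set enorm (p.1 - p.2) | p in W `*` W].

Definition supp f : set 'rV[R]_n := closure [set x | f x != 0].

Definition partial f (i : 'I_n) : 'rV[R]_n -> R :=
  fun x => 'D_(delta_mx 0 i) f x.

Definition partials f (s : seq 'I_n) : 'rV[R]_n -> R := foldl partial f s.

Definition smooth_on W f : Prop :=
  forall (s : seq 'I_n) x, W x ->
    {for x, continuous (partials f s)} /\
    forall i : 'I_n, derivable (partials f s) x (delta_mx 0 i).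

Definition multi_index := {ffun 'I_n -> nat}.

Definition mi_abs (alpha : multi_index) : nat := \sum_i alpha i.

Definition monomial (alpha : multi_index) x : R := \prod_i x 0 i ^+ alpha i.

Definition mi_partial (alpha : multi_index) f : 'rV[R]_n -> R :=
  partials f (flatten [seq nseq (alpha i) i | i <- enum 'I_n]).

Definition compact_in (K Omega : set 'rV[R]_n) : Prop :=
  compact K /\ K `<=` Omega.

Definition test_function phi : Prop := smooth_on setT phi /\ compact (supp phi).

Definition odot (r : R) phi : 'rV[R]_n -> R :=
  fun y => r ^- n * phi (r^-1 *: y).

Definition A0 : set ('rV[R]_n -> R) :=
  [set phi | test_function phi /\ integralRn phi = 1].

Definition Aq (q : nat) : set ('rV[R]_n -> R) :=
  [set phi | A0 phi /\ forall alpha : multi_index,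
     (1 <= mi_abs alpha <= q)%N ->
     integralRn (fun x => monomial alpha x * phi x) = 0].

Definition Ie : set (set ('rV[R]_n -> R)) := [set Aq q | q in [set: nat]].

Definition le_e (eps e : 'rV[R]_n -> R) : Prop :=
  exists2 r : R, 0 < r <= 1 & eps = odot r e.

Definition down_e (e : 'rV[R]_n -> R) : set ('rV[R]_n -> R) :=
  [set eps | A0 eps /\ le_e eps e].

(* x_eps = O(y_eps) as eps \in I^e *)
Definition bigO_e (x y : ('rV[R]_n -> R) -> R) : Prop :=
  exists2 A, Ie A & forall a, A a ->
    exists2 H : R, 0 < H & exists2 eps0, (down_e a `&` A) eps0 &
      forall eps, (down_e eps0 `&` A) eps -> `|x eps| <= H * `|y eps|.

End euclidean_space.
Arguments multi_index n : clear implicits.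

Section full_algebra.
Context {R : realType} {n : nat}.
Variable Omega : set 'rV[R]_n.
Implicit Types (phi : 'rV[R]_n -> R) (x : 'rV[R]_n).

(* U(Omega) is the set of the (phi, x) with phi in A_0 and x in Omega_ phi. *)
Definition Omega_ phi : set 'rV[R]_n :=
  [set x | Omega x /\ supp phi `<=` [set w - x | w in Omega]].

(* The supremum over K is assigned the value 0 when K is not included in
   Omega_ phi. *)
Definition sup_on phi (K : set 'rV[R]_n) (g : 'rV[R]_n -> R) : R :=
  if `[< K `<=` Omega_ phi >] then sup [set `|g x| | x in K] else 0.

Definition Ee : set (('rV[R]_n -> R) * 'rV[R]_n -> R) :=
  [set F | forall phi, A0 phi -> smooth_on (Omega_ phi) (fun x => F (phi, x))].

Definition EMe : set (('rV[R]_n -> R) * 'rV[R]_n -> R) :=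
  [set F | Ee F /\
    forall K, compact_in K Omega -> forall alpha : multi_index n,
    exists N : nat, forall phi, Aq N phi ->
      ((fun r => sup_on (odot r phi) K
                   (mi_partial alpha (fun x => F (odot r phi, x)))) : R -> R^o)
      =O_ (0^'+) (fun r => r ^- N : R^o)].

Definition Ne : set (('rV[R]_n -> R) * 'rV[R]_n -> R) :=
  [set F | Ee F /\
    forall K, compact_in K Omega -> forall alpha : multi_index n,
    forall m : nat, exists q : nat, forall phi, Aq q phi ->
      ((fun r => sup_on (odot r phi) K
                   (mi_partial alpha (fun x => F (odot r phi, x)))) : R -> R^o)
      =O_ (0^'+) (fun r => r ^+ m : R^o)].

Definition Pe : set (('rV[R]_n -> R) -> 'rV[R]_n -> R) :=
  [set u | forall eps, A0 eps -> smooth_on (Omega_ eps) (u eps)].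

Definition vee (u : ('rV[R]_n -> R) -> 'rV[R]_n -> R) :
  ('rV[R]_n -> R) * 'rV[R]_n -> R := fun p => u p.1 p.2.

End full_algebra.

(* Main.v *)
(** For a kernel [e] in A_0 the elements below [e] are the [odot r e] with
    [0 < r <= 1], and [diam (supp (odot r e)) = r * diam (supp e)] where
    [diam (supp e) > 0].  A power of the diameter along the ray through [e] is
    therefore a positive constant times the same power of [r], so an estimate
    in [r] as [r -> 0+] and an estimate in the diameter below some [odot r0 e]
    are the same thing.  Restarting the ray at [odot r0 e] stays in A_q, as the
    sets A_q are invariant under [odot r]; this rests on the change of variables
    [t |-> r t] in the iterated Lebesgue integral. *)
Require Import Defs.
From HB Require Import structures.
From mathcomp Require Import all_boot all_order all_algebra.
From mathcomp Require Import all_classical all_reals all_analysis.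
From mathcomp Require Import measurable_realfun ring.
Import Order.TTheory GRing.Theory Num.Theory.
Import numFieldNormedType.Exports.
Local Open Scope classical_set_scope.
Local Open Scope ring_scope.

(** * Change of variables for a bijection that multiplies a measure by a constant *)

Section change_of_variables.
Set Implicit Arguments.
Unset Strict Implicit.
Local Open Scope ereal_scope.
Import HBNNSimple.
Context {d : measure_display} {T : measurableType d} {R : realType}.
Variable mu : {measure set T -> \bar R}.

(* No measurability of [f] is needed: the integral is a supremum over simple
   functions, and these are transported by the bijection. *)
Lemma ge0_integral_comp_le (S S' : T -> T) (k c : R) (f : T -> \bar R) :
  measurable_fun setT S -> measurable_fun setT S' -> cancel S S' ->
  cancel S' S -> (0 < k)%R -> (0 < c)%R ->
  (forall A, measurable A -> mu (S @^-1` A) = k%:E * mu A) ->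
  (forall x, 0 <= f x) ->
  \int[mu]_x (c%:E * f (S x)) <= (c * k)%:E * \int[mu]_x f x.
Proof.
move=> mS mS' SK S'K k0 c0 muS f0.
rewrite ge0_integralTE; last by move=> x; rewrite mule_ge0// lee_fin ltW.
apply: ge_ereal_sup => _ [h /= hf <-].
rewrite -integralT_nnsfun.
(* Chosen so that [c * g (S x) = h x]; substituting [S' x] in the bound on [h] gives [g <= f]. *)
pose g x := (c^-1 * h (S' x))%R.
have g0 x : (0 <= g x)%R by rewrite mulr_ge0 ?invr_ge0 ?(ltW c0).
have mg : measurable_fun setT g.
  by apply: measurable_funM => //; exact: measurableT_comp.
have mgE : measurable_fun setT (EFin \o g) by exact/measurable_EFinP.
have -> : \int[mu]_x (h x)%:E = c%:E * \int[mu]_x (EFin \o g) (S x).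
  rewrite -ge0_integralZl//; last 3 first.
  - exact: measurableT_comp.
  - by move=> x _; rewrite lee_fin.
  - by rewrite lee_fin ltW.
  by apply: eq_integral => x _; rewrite /g /= SK -EFinM mulVKf ?gt_eqF.
have -> : \int[mu]_x (EFin \o g) (S x) = k%:E * \int[mu]_x (EFin \o g) x.
  have -> : \int[mu]_x (EFin \o g) (S x) =
      \int[pushforward mu S]_x (EFin \o g) x.
    by rewrite ge0_integral_pushforward// => x _; rewrite lee_fin.
  have k0' : (0 <= k)%R by exact: ltW.
  rewrite [LHS](eq_measure_integral (mscale (NngNum k0') mu)).
    by rewrite ge0_integral_mscale// => x _; rewrite lee_fin.
  by move=> A mA _; exact: muS.
rewrite muleA -EFinM lee_pmul2l ?fin_numE// ?lte_fin ?mulr_gt0//.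
rewrite (ge0_integralTE mu f0).
(* With finitely many values [g] is a simple function below [f], so its integral is one of those
   whose supremum is the integral of [f]. *)
have fing : finite_set (range g).
  apply: (@sub_finite_set _ _ ((fun y => c^-1 * y)%R @` range h)).
    by move=> _ [x _ <-]; exists (h (S' x)) => //; exists (S' x).
  exact: finite_image.
pose g1 : {nnsfun T >-> R} := HB.pack g (isMeasurableFun.Build _ _ _ _ _ mg)
  (FiniteImage.Build _ _ _ fing) (isNonNegFun.Build _ _ _ g0).
rewrite (integralT_nnsfun _ g1); apply: ereal_sup_ubound; exists g1 => //= x.
by rewrite EFinM lee_pdivrMl// -{2}(S'K x).
Qed.

(** For nonnegative functions the reverse inequality is the previous bound applied to the inverse
    map [S'], with constants [k^-1] and [c^-1]. The general case splits [f] into its positive and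
    negative parts. *)
Lemma integral_comp (S S' : T -> T) (k c : R) (f : T -> \bar R) :
  measurable_fun setT S -> measurable_fun setT S' ->
  cancel S S' -> cancel S' S -> (0 < k)%R -> (0 < c)%R ->
  (forall A, measurable A -> mu (S @^-1` A) = k%:E * mu A) ->
  \int[mu]_x (c%:E * f (S x)) = (c * k)%:E * \int[mu]_x f x.
Proof.
move=> mS mS' SK S'K k0 c0 muS.
have muS' A : measurable A -> mu (S' @^-1` A) = k^-1%:E * mu A.
  move=> mA; have mS'A : measurable (S' @^-1` A).
    by rewrite -[X in measurable X]setTI; exact: mS'.
  have := muS _ mS'A; rewrite -comp_preimage.
  have -> : S' \o S = id by apply/funext => x /=; rewrite SK.
  by rewrite preimage_id => ->; rewrite muleA -EFinM mulVf ?gt_eqF// mul1e.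
have ck0 : (0 < c * k)%R by rewrite mulr_gt0.
have nonneg g : (forall x, 0 <= g x) ->
    \int[mu]_x (c%:E * g (S x)) = (c * k)%:E * \int[mu]_x g x.
  move=> g0; apply/eqP; rewrite eq_le (ge0_integral_comp_le mS mS')//=.
  rewrite -lee_pdivlMl//.
  have cg0 x : 0 <= c%:E * g (S x) by rewrite mule_ge0// lee_fin ltW.
  have ci0 : (0 < c^-1)%R by rewrite invr_gt0.
  have ki0 : (0 < k^-1)%R by rewrite invr_gt0.
  have := ge0_integral_comp_le mS' mS S'K SK ki0 ci0 muS' cg0.
  rewrite -invfM; under eq_integral.
    by move=> x _; rewrite S'K muleA -EFinM mulVf ?gt_eqF// mul1e; over.
  exact: id.
rewrite integralE [in RHS]integralE (ge0_funeposM _ (ltW c0)).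
rewrite (ge0_funenegM _ (ltW c0)).
have -> : \int[mu]_x (c%:E * (fun y => f (S y))^\+ x) =
    (c * k)%:E * \int[mu]_x f^\+ x.
  rewrite -(nonneg _ (funepos_ge0 f)).
  by apply: eq_integral => x _; rewrite funeposE [in RHS]funeposE.
have -> : \int[mu]_x (c%:E * (fun y => f (S y))^\- x) =
    (c * k)%:E * \int[mu]_x f^\- x.
  rewrite -(nonneg _ (funeneg_ge0 f)).
  by apply: eq_integral => x _; rewrite funenegE [in RHS]funenegE.
have : 0 <= \int[mu]_x f^\+ x by exact: integral_ge0.
have : 0 <= \int[mu]_x f^\- x by exact: integral_ge0.
(* Either part may have integral [+oo]. A positive finite factor preserves each infinite case,
   including the conventional value of [oo - oo]. *)
move: (\int[mu]_x f^\+ x) (\int[mu]_x f^\- x) => [a| |] [b| |] //= _ _.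
all: by rewrite -?EFinM ?gt0_muley ?gt0_muleNy ?lte_fin//= -?EFinM ?mulrBr
  ?gt0_muley ?gt0_muleNy ?lte_fin//.
Qed.

End change_of_variables.

(** * Lebesgue measure under dilations *)

Section dilation.
Set Implicit Arguments.
Unset Strict Implicit.
Context {R : realType}.

Fixpoint scale_coord (r : R) (n : nat) : coordType R n -> coordType R n :=
  if n is m.+1 return coordType R n -> coordType R n
  then fun t => (r * t.1, scale_coord r t.2) else id.

Lemma scale_coordK (r : R) n : r != 0 ->
  cancel (@scale_coord r n) (@scale_coord r^-1 n).
Proof.
by move=> r0; elim: n => [|n IHn] //= -[x t] /=; rewrite mulKf// IHn.
Qed.

Lemma point_of_scale_coord (r : R) n (t : coordType R n) :
  point_of_coord (scale_coord r t) = r *: point_of_coord t.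
Proof.
apply/rowP => i; rewrite !mxE; move: (nat_of_ord i) => {i}.
by elim: n t => [|n IHn] t j /=; [rewrite mulr0|case: j => //= j].
Qed.

Lemma measurable_scale_coord (r : R) n :
  measurable_fun setT (@scale_coord r n).
Proof.
elim: n => [|n IHn] /=; first exact: measurable_id.
apply: measurable_fun_pair.
  by apply: (@measurableT_comp _ _ _ _ _ _ ( *%R r) _ fst).
by apply: (@measurableT_comp _ _ _ _ _ _ _ _ snd).
Qed.

(** Hides the scaled pushforward behind an abstract measure, ready for the uniqueness theorems for
    Lebesgue and product measures. *)
Lemma mscale_pushforward d (T : measurableType d)
    (mu : {measure set T -> \bar R}) (S : T -> T) (k : R) :
  0 <= k -> measurable_fun setT S ->
  exists m : {measure set T -> \bar R},
    forall A, (m A = k%:E * mu (S @^-1` A))%E.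
Proof.
move=> k0 mS.
by unshelve eexists (mscale (NngNum k0) (pushforward mu S)).
Qed.

(** By uniqueness of Lebesgue measure it suffices to compare half-open intervals, where both sides
    are lengths. *)
Lemma lebesgue_measure_scale (r : R) (A : set R) : 0 < r -> measurable A ->
  (lebesgue_measure A = r%:E * lebesgue_measure ( *%R r @^-1` A))%E.
Proof.
move=> r0 mA; have [m mE] := mscale_pushforward (@lebesgue_measure R) (ltW r0)
  (@mulrl_measurable R setT r).
have {}mE B : (m B = r%:E * lebesgue_measure ( *%R r @^-1` B))%E := mE B.
rewrite -mE.
apply: (@lebesgue_measure_unique _ m _ _ mA) => X /ocitvP[->|[[a b] /= ab ->]].
  by rewrite !measure0.
rewrite mE.
have -> : *%R r @^-1` `]a, b] = `](a / r), (b / r)]%classic.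
  apply/seteqP; split => x /=; rewrite !in_itv/= ltr_pdivrMr// ler_pdivlMr//;
  by rewrite mulrC.
rewrite !lebesgue_measure_itv/= !lte_fin ltr_pM2r ?invr_gt0// ab.
by rewrite -!EFinB -EFinM -mulrBl mulrC mulfVK ?gt_eqF.
Qed.

(** Induction on the dimension: a product measure is determined by rectangles, and these pull back
    to rectangles, factor by factor. *)
Lemma lebesgue_coord_scale (r : R) n (A : set (coordType R n)) : 0 < r ->
  measurable A ->
  (lebesgue_coord R n (@scale_coord r n @^-1` A) =
   (r ^- n)%:E * lebesgue_coord R n A)%E.
Proof.
move=> r0; have rn0 m : 0 <= r ^+ m by rewrite exprn_ge0// ltW.
(* With the factor on this side, the right-hand side is itself a measure evaluated at [A]. *)
suff H : measurable A -> (lebesgue_coord R n A =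
    (r ^+ n)%:E * lebesgue_coord R n (@scale_coord r n @^-1` A))%E.
  by move=> mA; rewrite H// muleA -EFinM mulVf ?mul1e// expf_eq0 gt_eqF ?andbF.
elim: n A => [|n IHn] A mA; first by rewrite expr0 mul1e.
have [m mE] := mscale_pushforward (lebesgue_coord R n.+1) (rn0 n.+1)
  (@measurable_scale_coord r n.+1).
rewrite -mE; apply: (@product_measure_unique _ _ _ _ _ (@lebesgue_measure R)
  (lebesgue_coord R n) m) => // B C mB mC.
rewrite mE /=.
have -> : (fun t : R * coordType R n => (r * t.1, scale_coord r t.2)) @^-1`
  (B `*` C) = ( *%R r @^-1` B) `*` (@scale_coord r n @^-1` C) by [].
rewrite /lebesgue_prod product_measure1E; last 2 first.
- by rewrite -[X in measurable X]setTI; apply: mulrl_measurable.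
- by rewrite -[X in measurable X]setTI; apply: measurable_scale_coord.
rewrite (lebesgue_measure_scale r0 mB) (IHn _ mC) exprS EFinM.
by rewrite muleACA.
Qed.

End dilation.

(** * Invariance of the sets A_q under [odot] *)

Section odot.
Set Implicit Arguments.
Unset Strict Implicit.
Context {R : realType} {n : nat}.
Implicit Types (f phi : 'rV[R]_n -> R) (r s : R).

Lemma integralRn_scale f (r c : R) : 0 < r -> 0 < c ->
  integralRn (fun x => c * f (r^-1 *: x)) = c * r ^+ n * integralRn f.
Proof.
move=> r0 c0; have rV0 : 0 < r^-1 by rewrite invr_gt0.
rewrite /integralRn /Rintegral.
have -> : (\int[lebesgue_coord R n]_t
      (c * f (r^-1 *: point_of_coord t))%:E)%E =
    (\int[lebesgue_coord R n]_t
      (c%:E * (f (point_of_coord (scale_coord r^-1 t)))%:E))%E.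
  by apply: eq_integral => t _; rewrite point_of_scale_coord EFinM.
rewrite (@integral_comp _ _ _ _ (@scale_coord R r^-1 n) (@scale_coord R r n)
  (r ^+ n) c (fun t => (f (point_of_coord t))%:E)) ?exprn_gt0//.
(* The real-valued integral sends infinite values to 0; a positive factor keeps them infinite, so
   both sides are then 0. *)
- have : 0 < c * r ^+ n by rewrite mulr_gt0// exprn_gt0.
  case: integral => [x| |] //= k0.
  + by rewrite gt0_muley ?lte_fin//= mulr0.
  + by rewrite gt0_muleNy ?lte_fin//= mulr0.
- exact: measurable_scale_coord.
- exact: measurable_scale_coord.
- by rewrite -[r in X in cancel _ X]invrK; apply: scale_coordK; rewrite gt_eqF.
- by apply: scale_coordK; rewrite gt_eqF.
- move=> A mA; rewrite -[r ^+ n]invrK -exprVn; exact: lebesgue_coord_scale.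
Qed.

Lemma odotM r s phi : odot s (odot r phi) = odot (s * r) phi.
Proof.
apply/funext => y; rewrite /odot scalerA mulrA -invfM -exprMn [r^-1 * _]mulrC.
by rewrite -invfM.
Qed.

Lemma odot1 phi : odot 1 phi = phi.
Proof. by apply/funext => y; rewrite /odot expr1n invr1 mul1r scale1r. Qed.

Lemma odotK r phi : r != 0 -> odot r^-1 (odot r phi) = phi.
Proof. by move=> r0; rewrite odotM mulVf// odot1. Qed.

Lemma integralRn_odot r phi : 0 < r ->
  integralRn (odot r phi) = integralRn phi.
Proof.
move=> r0; rewrite integralRn_scale ?invr_gt0 ?exprn_gt0//.
by rewrite mulVf ?mul1r// expf_eq0 gt_eqF ?andbF.
Qed.

Lemma monomialZ (alpha : multi_index n) r (x : 'rV[R]_n) :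
  monomial alpha (r *: x) = r ^+ mi_abs alpha * monomial alpha x.
Proof.
rewrite /monomial /mi_abs -prodrXr -big_split/=.
by apply: eq_bigr => i _; rewrite mxE exprMn.
Qed.

Lemma moment_odot r phi (alpha : multi_index n) : 0 < r ->
  integralRn (fun x => monomial alpha x * odot r phi x) =
  r ^+ mi_abs alpha * integralRn (fun x => monomial alpha x * phi x).
Proof.
move=> r0; have rX m : 0 < r ^+ m by rewrite exprn_gt0.
pose g y := monomial alpha y * phi y.
(* Homogeneity of the monomial moves the dilation inside it, so the moment becomes the integral of a
   rescaled [g]. *)
have -> : (fun x => monomial alpha x * odot r phi x) =
    fun x => r ^+ mi_abs alpha / r ^+ n * g (r^-1 *: x).
  apply/funext => x; rewrite /g /odot -{1}(scalerKV (lt0r_neq0 r0) x).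
  by rewrite monomialZ mulrCA !mulrA [_^-1 * _]mulrC.
by rewrite integralRn_scale ?divr_gt0// mulfVK ?gt_eqF.
Qed.

(** The difference quotient with step [h] is [c * r] times that of [f] with step [r * h]. This uses
    derivability in the single direction [v] only. *)
Lemma is_derive_scale f (x v : 'rV[R]_n) (r c : R) : r != 0 ->
  derivable f (r *: x) v ->
  is_derive x v (fun y => c * f (r *: y)) (c * r * 'D_v f (r *: x)).
Proof.
move=> r0 df; pose q h := h^-1 *: ((f \o shift (r *: x)) (h *: v) - f (r *: x)).
have r00 : r * h @[h --> 0^'] --> 0^'.
  move=> A nA; change (nbhs (0 : R) [set h | h != 0 -> A (r * h)]).
  have nA0 : nbhs (r * 0) [set h | h != 0 -> A h] by rewrite mulr0.
  have : nbhs (0 : R) [set h | r * h != 0 -> A (r * h)].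
    exact: (@mulrl_continuous R^o r 0 _ nA0).
  by apply: filterS => h /= Ah h0; apply: Ah; rewrite mulf_neq0.
have qE : (fun h => h^-1 *: (((fun y => c * f (r *: y)) \o shift x) (h *: v)
    - c * f (r *: x))) = (fun h => (c * r) * q (r * h)).
  apply/funext => h; rewrite /q /= /shift /=.
  rewrite (scalerDr r (h *: v) x) (scalerA r h v).
  have scaleE (a b : R) : a *: (b : R^o) = a * b by [].
  (* At [h = 0] both sides vanish because [0^-1 = 0], so the quotients agree as functions. *)
  rewrite !scaleE -mulrBr; have [->|h0] := eqVneq h 0.
    by rewrite mulr0 invr0 !mul0r mulr0.
  by field; rewrite r0 h0.
have qD : (c * r) * q (r * h) @[h --> 0^'] --> (c * r * 'D_v f (r *: x) : R^o).
  apply: cvgM; first exact: cvg_cst.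
  exact: (cvg_comp _ _ r00 df).
apply: DeriveDef; rewrite /derivable /derive qE; last exact/cvg_lim.
by apply/cvg_ex; exists (c * r * 'D_v f (r *: x)).
Qed.

Lemma partials_odot (s : seq 'I_n) r phi : 0 < r ->
  smooth_on setT phi ->
  partials (odot r phi) s =
    fun x => r ^- n * r ^- size s * partials phi s (r^-1 *: x).
Proof.
move=> r0 sphi; elim/last_ind: s => [|s i IHs].
  by rewrite /= expr0 invr1 mulr1.
rewrite /partials !foldl_rcons -!/(partials _ _) IHs size_rcons.
apply/funext => x; rewrite /partial.
have [_ df] := sphi s (r^-1 *: x) I.
have H := is_derive_scale (r ^- n * r ^- size s)
  (invr_neq0 (lt0r_neq0 r0)) (df i).
by rewrite (@derive_val _ _ _ _ _ _ _ H) exprS invfM; ring.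
Qed.

Lemma smooth_odot r phi : 0 < r -> smooth_on setT phi ->
  smooth_on setT (odot r phi).
Proof.
move=> r0 sphi s x _; have [cf df] := sphi s (r^-1 *: x) I.
rewrite partials_odot//; split => [|i].
  rewrite /prop_for /continuous_at.
  apply: (@cvgM R _ (nbhs x) _ (cst (r ^- n * r ^- size s))
    (fun y => partials phi s (r^-1 *: y))); first exact: cvg_cst.
  apply: (@cvg_comp _ _ _ (fun y => r^-1 *: y) (partials phi s)) cf.
  exact: scaler_continuous.
by have [] := is_derive_scale (r ^- n * r ^- size s)
  (invr_neq0 (lt0r_neq0 r0)) (df i).
Qed.

Lemma supp_odot_sub r phi x : r != 0 ->
  supp (odot r phi) x -> supp phi (r^-1 *: x).
Proof.
move=> r0 sx B nB.
have [|y [/= ny By]] := sx ((fun y => r^-1 *: y) @^-1` B).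
  exact: (@scaler_continuous R 'rV[R]_n r^-1 x B nB).
exists (r^-1 *: y); split => //=.
by apply: contra_neq ny; rewrite /odot => ->; rewrite mulr0.
Qed.

Lemma supp_odot r phi : r != 0 ->
  supp (odot r phi) = [set r *: x | x in supp phi].
Proof.
move=> r0; apply/seteqP; split => [x /(supp_odot_sub r0) sx|_ [x sx <-]].
  by exists (r^-1 *: x) => //; rewrite scalerKV.
(* The other inclusion is the same lemma for the inverse dilation, applied to [odot r phi]. *)
have := @supp_odot_sub r^-1 (odot r phi) x; rewrite odotK// invrK.
by apply; rewrite ?invr_neq0.
Qed.

Lemma test_function_odot r phi : 0 < r ->
  test_function phi -> test_function (odot r phi).
Proof.
move=> r0 [sphi cphi]; split; first exact: smooth_odot.
rewrite supp_odot ?gt_eqF//; apply: continuous_compact cphi.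
by apply: continuous_subspaceT; exact: scaler_continuous.
Qed.

Lemma A0_odot r phi : 0 < r -> A0 phi -> A0 (odot r phi).
Proof.
move=> r0 [tphi phi1]; split; first exact: test_function_odot.
by rewrite integralRn_odot.
Qed.

Lemma Aq_odot q r phi : 0 < r -> Aq q phi -> Aq q (odot r phi).
Proof.
move=> r0 [A0phi mphi]; split; first exact: A0_odot.
by move=> alpha ha; rewrite moment_odot// mphi// mulr0.
Qed.

End odot.

(** * Euclidean diameter of the support of a kernel *)

Section diameter.
Set Implicit Arguments.
Unset Strict Implicit.
Context {R : realType} {n : nat}.
Implicit Types (W : set 'rV[R]_n) (phi : 'rV[R]_n -> R) (r : R).

Lemma enormZ r (x : 'rV[R]_n) : 0 < r -> enorm (r *: x) = r * enorm x.
Proof.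
move=> r0; have rE : r = Num.sqrt (r ^+ 2) by rewrite sqrtr_sqr gtr0_norm.
rewrite /enorm [in RHS]rE -sqrtrM ?sqr_ge0// mulr_sumr; congr (Num.sqrt _).
by apply: eq_bigr => i _; rewrite mxE exprMn.
Qed.

Lemma enorm_gt0 (x : 'rV[R]_n) : x != 0 -> 0 < enorm x.
Proof.
move=> /rV0Pn[i xi]; rewrite sqrtr_gt0 (bigD1 i)//= ltr_pwDl//.
  by rewrite lt0r sqrf_eq0 xi sqr_ge0.
by apply: sumr_ge0 => j _; exact: sqr_ge0.
Qed.

(** Guarantees that the [sup] in [diam] is a true supremum rather than a default value. A bound in
    the sup norm bounds every coordinate of a difference, hence its Euclidean norm. *)
Lemma has_ubound_dist W : compact W ->
  has_ubound [set enorm (p.1 - p.2) | p in W `*` W].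
Proof.
move=> /compact_bounded[M [_ MW]].
have {}MW x : W x -> `|x| <= M + 1 by apply: MW; rewrite ltrDl.
exists (Num.sqrt (\sum_(i < n) ((M + 1) + (M + 1)) ^+ 2)).
move=> _ [[x y] /= [Wx Wy] <-].
apply: ler_wsqrtr; apply: ler_sum => i _.
rewrite -real_normK ?num_real//; apply: lerXn2r; rewrite ?nnegrE//.
  by rewrite addr_ge0// (le_trans _ (MW _ Wx)).
apply: (@le_trans _ _ `|x - y|); last first.
  by rewrite (le_trans (ler_normB _ _))// lerD// MW.
rewrite [leRHS]mx_normrE; exact: (le_bigmax _ _ (0, i)).
Qed.

Lemma sup_scale (E : set R) r : 0 < r -> has_sup E ->
  sup [set r * x | x in E] = r * sup E.
Proof.
move=> r0 [[x0 Ex0] [M ME]].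
have ub : has_ubound [set r * x | x in E].
  by exists (r * M) => _ [x Ex <-]; rewrite ler_pM2l// ME.
apply/eqP; rewrite eq_le; apply/andP; split.
  apply: ge_sup; first by exists (r * x0); exists x0.
  move=> _ [x Ex <-]; rewrite ler_pM2l//; apply: ub_le_sup => //.
  by exists M.
rewrite -ler_pdivlMl//; apply: ge_sup; first by exists x0.
move=> x Ex; rewrite ler_pdivlMl//; apply: ub_le_sup => //.
by exists x.
Qed.

Lemma diam_scale W r : 0 < r -> compact W -> W !=set0 ->
  diam [set r *: x | x in W] = r * diam W.
Proof.
move=> r0 cW [x Wx]; rewrite /diam -sup_scale//; last first.
  by split; [exists (enorm (x - x)); exists (x, x)|exact: has_ubound_dist].
congr sup; apply/seteqP; split.
  move=> _ [[_ _] /= [[y Wy <-] [z Wz <-]] <-].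
  exists (enorm (y - z)); first by exists (y, z).
  by rewrite -enormZ// scalerBr.
move=> _ [_ [[y z] /= [Wy Wz] <-] <-].
exists (r *: y, r *: z); first by split; [exists y|exists z].
by rewrite /= -enormZ// scalerBr.
Qed.

Lemma A0_neq0 phi : A0 phi -> exists x, phi x != 0.
Proof.
move=> [_ phi1]; apply: contrapT => phi0.
have E : phi = fun=> 0.
  by apply/funext => x; apply: contrapT => /eqP phix; apply: phi0; exists x.
move/eqP: phi1; rewrite E /integralRn /Rintegral integral0/=.
by rewrite eq_sym oner_eq0.
Qed.

Lemma supp_neq0 phi : A0 phi -> supp phi !=set0.
Proof. by move=> /A0_neq0[x px]; exists x; exact: subset_closure. Qed.

Lemma diam_supp_odot phi r : 0 < r -> A0 phi ->
  diam (supp (odot r phi)) = r * diam (supp phi).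
Proof.
move=> r0 Aphi; have [[_ cphi] _] := Aphi.
by rewrite supp_odot ?gt_eqF// diam_scale//; exact: supp_neq0.
Qed.

(** By continuity [phi] is nonzero at a second point, reached from [x] by a small step along a
    coordinate axis; such an axis exists since [1 <= n]. *)
Lemma diam_supp_gt0 phi : (1 <= n)%N -> A0 phi -> 0 < diam (supp phi).
Proof.
move=> n1 Aphi; have [x px] := A0_neq0 Aphi; have [[sphi cphi] _] := Aphi.
pose e : 'rV[R]_n := delta_mx 0 (Ordinal n1).
have e0 : e != 0.
  apply/rV0Pn; exists (Ordinal n1).
  by rewrite mxE !eqxx oner_neq0.
have [/= cx _] := sphi [::] x I.
have line : t *: e + x @[t --> (0 : R)] --> (0 : R) *: e + x.
  by apply: cvgD; [exact: scalel_continuous|exact: cvg_cst].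
rewrite scale0r add0r in line.
have cxe : phi (t *: e + x) @[t --> (0 : R)] --> phi x.
  exact: (cvg_comp _ _ line cx).
have : \forall t \near (0 : R), phi (t *: e + x) != 0.
  exact: (cvgr_neq0 (phi x) cxe px).
move=> /nbhs_ballP[d /= d0 dphi].
have d20 : 0 < d / 2 by rewrite divr_gt0.
have py : phi ((d / 2) *: e + x) != 0.
  by apply: dphi; rewrite /ball /= sub0r normrN gtr0_norm//
    ltr_pdivrMr// ltr_pMr// ltr1n.
apply: (@lt_le_trans _ _ (enorm ((d / 2) *: e))).
  by rewrite enorm_gt0// scaler_eq0 negb_or e0 gt_eqF.
apply: ub_le_sup; first exact: has_ubound_dist.
exists ((d / 2) *: e + x, x) => /=; first by split; exact: subset_closure.
by rewrite addrK.
Qed.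

End diameter.

(** * Passage between estimates along rays and [bigO_e] *)

Section bigO_rays.
Set Implicit Arguments.
Unset Strict Implicit.
Context {R : realType} {n : nat}.
Implicit Types (phi : 'rV[R]_n -> R) (X : ('rV[R]_n -> R) -> R) (g : R -> R).

Lemma Aq_sub (q p : nat) : (q <= p)%N -> @Aq R n p `<=` Aq q.
Proof.
move=> qp phi [A0phi mphi]; split=> // alpha /andP[a1 aq].
by apply: mphi; rewrite a1 (leq_trans aq).
Qed.

(** The function [g] stands for both [t ^- N] and [t ^+ m]. Multiplicativity splits [g] of the
    diameter of [odot r a] into [g r] and a constant depending on [a]. *)
Lemma bigO_e_of_rays X g q : (1 <= n)%N ->
  {morph g : s t / s * t} -> (forall t, 0 < t -> 0 < g t) ->
  (forall phi, Aq q phi ->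
    ((fun r => X (odot r phi)) : R -> R^o) =O_ (0^'+) (g : R -> R^o)) ->
  bigO_e X (fun eps => g (diam (supp eps))).
Proof.
move=> n1 gM g0 XO; exists (Aq q); first by exists q.
move=> a Aqa; have A0a : A0 a by case: Aqa.
have /eqO_exP[k k0] := XO a Aqa.
rewrite near_withinE => /nbhs_ballP[e /= e0 He].
have d0 := diam_supp_gt0 n1 A0a.
have gd0 := g0 _ d0.
(* The divisor cancels the constant factor that the diameter of [supp a] contributes. *)
exists (k / g (diam (supp a))); first by rewrite divr_gt0.
(* [e / 2] keeps every [s * r0] with [s <= 1] strictly inside the ball of validity; [1] keeps
   [odot r0 a] below [a]. *)
pose r0 := Num.min (e / 2) 1.
have r00 : 0 < r0 by rewrite lt_min divr_gt0//=.
have r0e : r0 < e.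
  by rewrite gt_min ltr_pdivrMr// ltr_pMr// ltr1n.
exists (odot r0 a).
  split; last exact: Aq_odot.
  split; first exact: A0_odot.
  by exists r0 => //; rewrite r00 ge_min lexx orbT.
move=> _ [[_ [s /andP[s0 s1] ->]] _]; rewrite odotM.
have sr0 : 0 < s * r0 by rewrite mulr_gt0.
rewrite diam_supp_odot// gM normrM (gtr0_norm gd0) mulrCA mulrA.
rewrite [X in _ <= X](_ : _ = k * `|g (s * r0)|); last by field; rewrite gt_eqF.
apply: He => //=; rewrite /ball /= sub0r normrN gtr0_norm//.
by rewrite (le_lt_trans _ r0e)// ler_piMl// ltW.
Qed.

Lemma rays_of_bigO_e X g : {morph g : s t / s * t} ->
  bigO_e X (fun eps => g (diam (supp eps))) ->
  exists q, forall phi, Aq q phi ->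
    ((fun r => X (odot r phi)) : R -> R^o) =O_ (0^'+) (g : R -> R^o).
Proof.
move=> gM [_ [q _ <-] HX]; exists q => phi Aphi.
have A0phi : A0 phi by case: Aphi.
have [H H0 [_ [[_ [r0 /andP[r00 _] ->]] _] HX0]] := HX _ Aphi.
(* Adding 1 makes the constant positive whatever the value of [g] at the diameter. *)
apply/eqO_exP; exists (H * (`|g (diam (supp phi))| + 1)).
  by rewrite mulr_gt0// ltr_wpDl.
near=> r.
have r1 : 0 < r by near: r; exact: nbhs_right_gt.
have rr0 : r < r0 by near: r; exact: nbhs_right_lt.
(* For [r < r0] the kernel [odot r phi] lies below [odot r0 phi], where the hypothesis gives its
   bound. *)
have E : odot r phi = odot (r / r0) (odot r0 phi).
  by rewrite odotM mulfVK// gt_eqF.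
have Ar : Aq q (odot r phi) by exact: Aq_odot.
have Ad : down_e (odot r0 phi) (odot r phi).
  split; first exact: A0_odot.
  by exists (r / r0) => //; rewrite divr_gt0//= ler_pdivrMr// mul1r ltW.
apply: (le_trans (HX0 _ (conj Ad Ar))); rewrite diam_supp_odot// gM normrM.
rewrite -mulrA ler_pM2l// mulrC ler_wpM2r// lerDl//.
Unshelve. all: by end_near. Qed.

End bigO_rays.

(** * Moderateness and negligibility *)

Theorem theorem25 (R : realType) (n : nat) (n_ge1 : (1 <= n)%N)
    (Omega : set 'rV[R]_n) (open_Omega : open Omega)
    (u : ('rV[R]_n -> R) -> 'rV[R]_n -> R) (u_Pe : Pe Omega u) :
  (EMe Omega (vee u) <->
   forall K : set 'rV[R]_n, compact_in K Omega ->
   forall alpha : multi_index n, exists N : nat,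
     bigO_e (fun eps => sup_on Omega eps K (mi_partial alpha (u eps)))
            (fun eps => diam (supp eps) ^- N)) /\
  (Ne Omega (vee u) <->
   forall K : set 'rV[R]_n, compact_in K Omega ->
   forall alpha : multi_index n, forall m : nat,
     bigO_e (fun eps => sup_on Omega eps K (mi_partial alpha (u eps)))
            (fun eps => diam (supp eps) ^+ m)).
Proof.
pose S (K : set 'rV[R]_n) alpha eps :=
  sup_on Omega eps K (mi_partial alpha (u eps)).
have XM m : {morph (fun t : R => t ^+ m) : s t / s * t}.
  by move=> s t; rewrite exprMn.
have XVM m : {morph (fun t : R => t ^- m) : s t / s * t}.
  by move=> s t; rewrite exprMn invfM.
split; split.
- move=> [_ uO] K KO alpha; have [N uN] := uO K KO alpha; exists N.
  apply: (@bigO_e_of_rays _ _ (S K alpha) (fun t => t ^- N) N) => //.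
  by move=> t t0; rewrite invr_gt0 exprn_gt0.
- move=> uO; split=> [phi A0phi|K KO alpha]; first exact: u_Pe.
  have [N uN] := uO K KO alpha.
  have [q Hq] := @rays_of_bigO_e _ _ (S K alpha) (fun t => t ^- N) (XVM N) uN.
  (* In [EMe] one number is both the moment order and the exponent. The maximum serves as both: the
     sets A_q decrease in q, and [r ^- N] grows with [N] for [r < 1]. *)
  exists (maxn q N) => phi Aphi.
  have /eqO_exP[k k0 Hk] := Hq phi (Aq_sub (leq_maxl q N) Aphi).
  apply/eqO_exP; exists k => //; near=> r.
  apply: (@le_trans _ _ (k * `|r ^- N|)); first by near: r.
  have r0 : 0 < r by near: r; exact: nbhs_right_gt.
  have r1 : r < 1 by near: r; exact: nbhs_right_lt.
  rewrite ler_pM2l// !gtr0_norm ?invr_gt0 ?exprn_gt0//.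
  rewrite lef_pV2 ?posrE ?exprn_gt0//; apply: ler_wiXn2l; rewrite ?ltW//.
  exact: leq_maxr.
- move=> [_ uO] K KO alpha m; have [q uq] := uO K KO alpha m.
  apply: (@bigO_e_of_rays _ _ (S K alpha) (fun t => t ^+ m) q) => //.
  by move=> t t0; rewrite exprn_gt0.
(* In [Ne] the moment order [q] is chosen separately from the exponent [m], so the ray estimate
   applies directly. *)
- move=> uO; split=> [phi A0phi|K KO alpha m]; first exact: u_Pe.
  exact: (@rays_of_bigO_e _ _ (S K alpha) (fun t => t ^+ m) (XM m)
    (uO K KO alpha m)).
Unshelve. all: by end_near. Qed.
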